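(* Let $m$ and $n$ be positive integers with $n$ composite. The following statements are equivalent: (a) $n$ is a Carmichael number of order $m$; (b) the function $x\mapsto x^n$ defines an endomorphism of every finite étale $\mathbf{Z}/n\mathbf{Z}$-algebra that can be generated as a $\mathbf{Z}/n\mathbf{Z}$-module by $m$ elements; (c) the following two conditions hold: (i) $n$ is squarefree; (ii) for every prime divisor $p$ of $n$ and for every integer $r$ with $1\le r\le m$, there is an integer $i\ge 0$ such that $n\equiv p^i \pmod{p^r-1}$.
   Context: Rings have identity elements and ring homomorphisms preserve identities. For a positive integer $m$, a Carmichael number of order $m$ is a positive composite integer $n$ such that the function $x\mapsto x^n$ defines a ring endomorphism of every $\mathbf{Z}/n\mathbf{Z}$-algebra that can be generated as a $\mathbf{Z}/n\mathbf{Z}$-module by $m$ elements. Finite étale algebras: if $R$ is a local ring, an $R$-algebra $S$ is finite étale if it is free of finite rank as an $R$-module and for some (equivalently every) $R$-basis $e_1,\dots,e_k$ of $S$ the determinant of the matrix $[\mathrm{Tr}_{S/R}(e_ie_j)]$ is a unit of $R$. If $R=R_1\times\cdots\times R_t$ with each $R_j$ local, an $R$-algebra $S$ is finite étale if $S=S_1\times\cdots\times S_t$ with each $S_j$ a finite étale $R_j$-algebra (the zero ring being allowed). This applies to the finite ring $\mathbf{Z}/n\mathbf{Z}$. *)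

(* Defs.v *)
From HB Require Import structures.
From mathcomp Require Import all_boot all_order all_algebra.
Set Implicit Arguments. Unset Strict Implicit. Unset Printing Implicit Defensive.
Import GRing.Theory.
Local Open Scope ring_scope.

Definition composite (n : nat) : Prop := (1 < n)%N /\ ~~ prime n.

Definition module_generated_by (n m : nat) (A : comAlgType 'Z_n) : Prop :=
  exists s : 'I_m -> A,
    forall x : A, exists c : 'I_m -> 'Z_n, x = \sum_(i < m) c i *: s i.

Definition pow_is_ring_endo (n : nat) (R : comNzRingType) : Prop :=
  [/\ forall x y : R, (x + y) ^+ n = x ^+ n + y ^+ n,
      forall x y : R, (x * y) ^+ n = x ^+ n * y ^+ n
    & (1 : R) ^+ n = 1].

Definition carmichael_of_order (m n : nat) : Prop :=
  composite n /\
  forall A : comAlgType 'Z_n, module_generated_by m A -> pow_is_ring_endo n A.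

(* Finite etale 'Z_n-algebras.
   'Z_n = prod_{p | n} Z/p^k (k = logn p n), and an algebra A decomposes
   accordingly as A = prod_p A_p with A_p = e_p A = {x in A | p^k x = 0}
   (a Z/p^k-algebra).  A_p is finite etale over the local ring Z/p^k iff
   it is free of finite rank r over Z/p^k with a basis b such that the
   determinant of [Tr(b_i b_j)] is a unit of Z/p^k.  We encode Z/p^k
   scalars by 'Z_n scalars (acting on A_p through Z/p^k): [coord x i]
   is a coordinate of x in the basis b, coordinates being unique modulo
   p^k; Tr(y) = sum_l coord (y * b_l) l; and a class mod p^k is a unit
   iff it is coprime to p. *)
Definition local_component_etale (n p : nat) (A : comAlgType 'Z_n) : Prop :=
  let q := (p ^ logn p n)%N in
  exists (r : nat) (b : 'I_r -> A) (coord : A -> 'I_r -> 'Z_n),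
    [/\ forall i, b i *+ q = 0,
        forall x : A, x *+ q = 0 -> x = \sum_(i < r) coord x i *: b i,
        forall c : 'I_r -> 'Z_n, \sum_(i < r) c i *: b i = 0 ->
          forall i, (q %| c i)%N
      &
        coprime p
          (\det (\matrix_(i < r, j < r)
                    \sum_(l < r) coord (b i * b j * b l) l) : 'Z_n)].

Definition finite_etale (n : nat) (A : comAlgType 'Z_n) : Prop :=
  forall p, prime p -> (p %| n)%N -> local_component_etale p A.

Definition etale_carmichael_of_order (m n : nat) : Prop :=
  forall A : comAlgType 'Z_n,
    finite_etale A -> module_generated_by m A -> pow_is_ring_endo n A.

Definition squarefree (n : nat) : Prop :=
  forall p, prime p -> ~~ (p * p %| n)%N.

Definition korselt_order (m n : nat) : Prop :=
  squarefree n /\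
  forall p, prime p -> (p %| n)%N ->
    forall r, (1 <= r <= m)%N ->
      exists i : nat, n = (p ^ i)%N %[mod (p ^ r).-1].

(* Main.v *)
Require Import Defs.
From HB Require Import structures.
From mathcomp Require Import all_boot all_order all_algebra.
From mathcomp Require Import all_fingroup all_solvable all_field ring.

(* (c) => (a): every prime p dividing n exceeds m + 1; otherwise taking r = p - 1
   at another prime q dividing n gives n = q^i modulo p, although p divides n.
   Let A be generated by m elements and z = (x + y)^n - x^n - y^n. In a residue
   field of A, of order p^r with r <= m, the n-th power map is x |-> x^(p^i), so z
   is nilpotent. For k = n / p the Frobenius gives k^p z = v^p, where
   v = k ((x + y)^k - x^k - y^k) is nilpotent and killed by p; such a v satisfies
   v^(m+1) = 0, hence v^p = 0 and k^p z = 0. Letting p vary, z = 0.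

   (b) => (c): Z/n itself forces n to be squarefree. The field F of order p^r is
   finite etale over Z/n because the matrix V = [b_i^(p^k)] is invertible and
   turns the trace form into V V^T. If x |-> x^n is additive on F, reduce n modulo
   p^r - 1 to an exponent k < p^r; then (X + 1)^k = X^k + 1 as polynomials, which
   forces k to be a power of p. *)

Set Implicit Arguments. Unset Strict Implicit. Unset Printing Implicit Defensive.
Import GRing.Theory.
Local Open Scope ring_scope.

(** * Frobenius congruences and torsion *)

(** The middle binomial coefficients are divisible by [p]. The remainder is kept as a multiple of
    [p] because [R] need not have characteristic [p]. *)
Lemma exprD_prime (R : comNzRingType) (p : nat) (x y : R) : prime p ->
  exists c : R, (x + y) ^+ p = x ^+ p + y ^+ p + c *+ p.
Proof.
case: p => [//|p] pr_p.
exists (\sum_(i < p) (x ^+ (p - i) * y ^+ i.+1) *+ ('C(p.+1, i.+1) %/ p.+1)).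
rewrite exprDn big_ord_recl subn0 bin0 mulr1n expr0 mulr1 -addrA; congr (_ + _).
rewrite big_ord_recr /= /bump leq0n add1n subnn binn mulr1n expr0 mul1r addrC.
congr (_ + _); rewrite -sumrMnl; apply: eq_bigr => i _.
rewrite -mulrnA /bump leq0n add1n subSS divnK //.
by apply: prime_dvd_bin => //=; rewrite ?ltnS ?ltn_ord.
Qed.

(** Multiplying by [b] stands for passing to [R / Ann(b)], which has characteristic [p], so
    Frobenius is additive there. *)
Lemma exprD_prime_expn (R : comNzRingType) (p i : nat) (b x y : R) :
    prime p -> b *+ p = 0 ->
  (x + y) ^+ (p ^ i) * b = x ^+ (p ^ i) * b + y ^+ (p ^ i) * b.
Proof.
move=> pr_p pb0; elim: i x y => [|i IHi] x y; first by rewrite mulrDl.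
have [c Dc] := exprD_prime x y pr_p.
rewrite expnS !exprM Dc; do !rewrite IHi.
rewrite -[RHS]addr0; congr (_ + _); rewrite -mulr_natr exprMn.
have /prednK <-: (0 < p ^ i)%N by rewrite expn_gt0 prime_gt0.
by rewrite [_%:R ^+ _]exprSr -!mulrA mulr_natl pb0 !mulr0.
Qed.

(** By Bezout, [gcdn n k] also kills [z]; it is smaller than [n] when [k] is coprime to a prime
    factor of [n]. *)
Lemma coprime_torsion0 (M : zmodType) (z : M) (n : nat) :
    (0 < n)%N -> z *+ n = 0 ->
    (forall p, prime p -> (p %| n)%N -> exists2 k, coprime p k & z *+ k = 0) ->
  z = 0.
Proof.
elim/ltn_ind: n => n IHn n_gt0 zn0 tors.
have [n_le1 | n_gt1] := leqP n 1.
  by move: zn0; rewrite (@anti_leq n 1) ?n_le1.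
have [k co_pk zk0] := tors _ (pdiv_prime n_gt1) (pdiv_dvd n).
have zg0: z *+ gcdn n k = 0.
  case: (egcdnP k n_gt0) => a c Da _.
  have := congr1 (GRing.natmul z) Da.
  by rewrite mulrnDr (mulnC _ n) (mulnC _ k) !mulrnA zn0 zk0 !mul0rn add0r.
have g_gt0: (0 < gcdn n k)%N by rewrite gcdn_gt0 n_gt0.
have gn: (gcdn n k %| n)%N by rewrite dvdn_gcdl.
apply: (IHn (gcdn n k)) => //; last first.
  by move=> p pr_p pg; apply: tors => //; apply: dvdn_trans gn.
rewrite ltn_neqAle dvdn_leq // andbT; apply: contraTneq co_pk => ng.
rewrite prime_coprime ?pdiv_prime // negbK.
by apply: (dvdn_trans (pdiv_dvd n)); rewrite -ng dvdn_gcdr.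
Qed.

(** * Nilpotent elements killed by a prime *)

(** Natural coefficients require no scalar action, so the notion applies to a bare ring. *)
Definition spans_nat (m : nat) (M : nmodType) (s : 'I_m -> M) : Prop :=
  forall x : M, exists c : 'I_m -> nat, x = \sum_(i < m) s i *+ c i.

Lemma spans_nat_choice (m : nat) (M : nmodType) (s : 'I_m -> M) k (x : 'I_k -> M) :
  spans_nat s -> exists c : 'I_k -> 'I_m -> nat,
    forall j, x j = \sum_(i < m) s i *+ c j i.
Proof.
move=> spans; elim: k x => [|k IHk] x; first by exists (fun _ _ => 0%N) => -[].
have [c Dc] := IHk (fun j => x (lift ord0 j)); have [c0 Dc0] := spans (x ord0).
exists (fun j => if unlift ord0 j is Some j' then c j' else c0) => j.
by case: unliftP => [j' ->|->].
Qed.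

(** The multiples of [v] form an ['F_p]-space spanned by the [m] elements [v * s i], so
    [v, ..., v^(m+1)] are linearly dependent. The lowest term of a relation lowers any vanishing
    exponent above [m + 1]. *)
Lemma nilp_expS_eq0 (R : comNzRingType) (m p k : nat) (s : 'I_m -> R) (v : R) :
  spans_nat s -> prime p -> v *+ p = 0 -> v ^+ k = 0 -> v ^+ m.+1 = 0.
Proof.
move=> spans pr_p pv0 vk0.
have [c Dc] := spans_nat_choice (fun j : 'I_m.+1 => v ^+ j) spans.
(* Row [j] holds the coefficients of [v^j] modulo [p]; there are more rows than columns, so the left
   kernel is nonzero. *)
pose C : 'M['F_p]_(m.+1, m) := \matrix_(j, i) (c j i)%:R.
have /rowV0Pn[u /sub_kermxP uC0 u_neq0]: kermx C != 0.
  by rewrite -mxrank_eq0 mxrank_ker -lt0n subn_gt0 ltnS rank_leq_col.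
have pvn l : (p %| l)%N -> v *+ l = 0.
  by case/dvdnP=> l' ->; rewrite mulnC mulrnA pv0 mul0rn.
(* Since [p] kills [v], one extra factor [v] turns the relation modulo [p] into an exact one. *)
have dep: \sum_(j < m.+1) v ^+ j.+1 *+ u 0 j = 0.
  rewrite (eq_bigr (fun j => \sum_(i < m) (v * s i) *+ (c j i * u 0 j))).
    rewrite exchange_big big1 //= => i _.
    rewrite sumrMnr -mulrnAl pvn ?mul0r // (dvdn_pcharf (pchar_Fp pr_p)).
    have /matrixP/(_ 0 i) := uC0; rewrite !mxE => uCi.
    rewrite natr_sum -[X in _ == X]uCi.
    by apply/eqP; apply: eq_bigr => j _; rewrite mxE natrM mulrC natr_Zp.
  move=> j _; rewrite exprS Dc mulr_sumr -sumrMnl; apply: eq_bigr => i _.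
  by rewrite mulrnAr mulrnA.
have [j0 uj0]: exists j0, u 0 j0 != 0.
  apply/existsP; apply: contraNT u_neq0 => /existsPn u0.
  by apply/eqP/rowP=> j; rewrite mxE; apply/eqP/negPn/u0.
pose a := [arg min_(j < j0 | u 0 j != 0) (j : nat)].
have [ua_neq0 a_min]: u 0 a != 0 /\ forall j : 'I_m.+1, (j < a)%N -> u 0 j = 0.
  rewrite /a; case: arg_minnP => // i ui_neq0 i_min; split=> // j.
  by rewrite ltnNge; apply: contraNeq => /i_min.
(* Multiplying the relation by [v ^+ (h - a)] isolates its lowest term. *)
have descend h : (m < h)%N -> v ^+ h.+1 = 0 -> v ^+ h = 0.
  move=> lt_mh vh0; have le_ah: (a < h)%N by apply: leq_trans lt_mh.
  have := congr1 (fun y => v ^+ (h - a.+1) * y) dep.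
  rewrite mulr0 mulr_sumr (bigD1 a) //= big1 ?addr0 => [|j ne_ja].
    rewrite mulrnAr -exprD subnK // => vu0.
    have co: coprime p (u 0 a).
      rewrite prime_coprime // (dvdn_pcharf (pchar_Fp pr_p)).
      by rewrite natr_Zp.
    apply: (@coprime_torsion0 _ _ p); rewrite ?prime_gt0 //.
      by rewrite -[h](ltn_predK le_ah) exprS -mulrnAl pv0 mul0r.
    move=> q pr_q; rewrite dvdn_prime2 // => /eqP->.
    by exists (u 0 a).
  have [lt_ja | le_aj] := ltnP j a; first by rewrite a_min ?mulr0.
  have lt_aj: (a < j)%N by rewrite ltn_neqAle eq_sym ne_ja.
  rewrite mulrnAr -exprD.
  have /subnK <-: (h.+1 <= h - a.+1 + j.+1)%N.
    by rewrite addnS ltnS -leq_subLR subnBA // addnC addnK.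
  by rewrite exprD vh0 mulr0 mul0rn.
have [le_kSm | lt_Smk] := leqP k m.+1; first by rewrite -(subnK le_kSm) exprD vk0 mulr0.
rewrite -(subnK (ltnW lt_Smk)) in vk0.
elim: (k - m.+1)%N vk0 => [|l IHl] //.
by rewrite addSn => /descend vl; apply: IHl; apply: vl; rewrite ltn_addl.
Qed.

(** * Residue fields of a finite ring *)

(** [Ann(b)] is an associated prime of [R]; comparing [x * b] with [y * b] replaces computing in the
    quotient. *)
Definition prime_annihilator (R : comNzRingType) (b : R) : Prop :=
  b != 0 /\ forall x y : R, x * y * b = 0 -> x * b = 0 \/ y * b = 0.

(** The powers of [z] repeat from an index at most [#|R|], so some nonzero elements are fixed by a
    power [z^t]. If [b] is one with maximal annihilator, any nonzero [y * b] is fixed too and has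
    the same annihilator, which makes [Ann(b)] prime. *)
Lemma non_nilp_prime_annihilator (R : finComNzRingType) (z : R) :
    z ^+ #|R| != 0 ->
  exists2 b : R, z * b != 0 & prime_annihilator b.
Proof.
move=> z_nn.
have [i [t [le_i t_gt0 zit]]] :
    exists i t, [/\ (i <= #|R|)%N, (0 < t)%N & z ^+ (i + t) = z ^+ i].
  have /injectivePn[i [j ne_ij zij]] : ~~ injectiveb (fun i : 'I_#|R|.+1 => z ^+ i).
    by apply/negP => /injectiveP/leq_card; rewrite card_ord ltnn.
  wlog lt_ij : i j ne_ij zij / (i < j)%N.
    move=> IH; case: (ltngtP i j) => [lt_ij|lt_ji|eq_ij]; first exact: (IH i j).
      by apply: (IH j i) => //; rewrite eq_sym.
    by case/eqP: ne_ij; apply: val_inj.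
  by exists i, (j - i)%N; rewrite subn_gt0 subnKC ?(ltnW lt_ij) // -ltnS.
(* On the stable part of multiplication by [z], pick [b] with the largest annihilator. *)
pose S b := (b != 0) && (z ^+ t * b == b).
have S0: S (z ^+ i).
  rewrite /S -exprD addnC zit eqxx andbT; apply: contra_neq z_nn => zi0.
  by rewrite -(subnK le_i) exprD zi0 mulr0.
pose ann b := [set x : R | x * b == 0].
case: (@arg_maxnP _ _ S (fun b => #|ann b|) S0) => b /andP[b_neq0 /eqP zb] b_max.
exists b.
  apply: contra_neq b_neq0 => zb0.
  by rewrite -zb -(prednK t_gt0) exprSr -mulrA zb0 mulr0.
split=> // x y xyb; have [-> | yb_neq0] := eqVneq (y * b) 0; first by right.
left; apply/eqP; have: x \in ann (y * b) by rewrite inE mulrA xyb.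
have sub: ann b \subset ann (y * b).
  by apply/subsetP=> u; rewrite !inE mulrCA => /eqP->; rewrite mulr0.
have /b_max Syb: S (y * b) by rewrite /S yb_neq0 mulrCA zb /=.
have /eqP <- : ann b == ann (y * b) by rewrite eqEcard sub.
by rewrite inE.
Qed.

(* [R * b] plays the role of the finite field [R / Ann(b)], of order [p ^ r]. *)
Lemma prime_annihilator_fermat (R : finComNzRingType) (m p : nat)
    (s : 'I_m -> R) (b : R) :
    prime p -> b *+ p = 0 -> spans_nat s -> prime_annihilator b ->
  exists2 r, (1 <= r <= m)%N &
    forall x : R, x * b != 0 -> x ^+ (p ^ r).-1 * b = b.
Proof.
move=> pr_p pb0 spans [b_neq0 b_prime].
pose V : {set R} := [set x * b | x in [set: R]].
have VP x : x * b \in V by apply: imset_f; rewrite inE.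
have gV : group_set V.
  apply/group_setP; split; first by apply/imsetP; exists 0; rewrite ?mul0r.
  by move=> _ _ /imsetP[x _ ->] /imsetP[y _ ->]; rewrite FinRing.zmodMgE -mulrDl VP.
have pV : pgroup p (Group gV).
  apply/pgroupP => q pr_q /(Cauchy pr_q)[_ /imsetP[x _ ->] ox].
  rewrite inE -(dvdn_prime2 pr_q pr_p) -ox order_dvdn.
  by rewrite FinRing.zmodXgE -mulrnAr pb0 mulr0.
have [r cardV] : exists r, #|V| = (p ^ r)%N.
  by exists (logn p #|V|); apply: (card_pgroup pV).
exists r.
  apply/andP; split.
    rewrite lt0n; apply/eqP=> r0; move: cardV; rewrite r0 expn0 => /eqP/cards1P[v Vv].
    have := VP 1; have := VP 0; rewrite mul1r mul0r Vv !inE => /eqP<- /eqP b0.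
    by rewrite b0 eqxx in b_neq0.
  rewrite -(leq_exp2l _ _ (prime_gt1 pr_p)) -cardV.
  (* Coefficients below [p] suffice because [p] kills [b]; this bounds [#|V|] by [p ^ m]. *)
  have -> : (p ^ m)%N = #|{ffun 'I_m -> 'I_p}| by rewrite card_ffun !card_ord.
  rewrite -cardsT; pose h (c : {ffun 'I_m -> 'I_p}) := \sum_i (s i * b) *+ c i.
  apply: leq_trans (leq_imset_card h _).
  apply/subset_leq_card/subsetP=> _ /imsetP[x _ ->].
  have [c ->] := spans x; apply/imsetP.
  exists [ffun i => Ordinal (ltn_pmod (c i) (prime_gt0 pr_p))] => //.
  rewrite /h mulr_suml; apply: eq_bigr => i _.
  rewrite ffunE /= mulrnAl {1}(divn_eq (c i) p) mulrnDr.
  by rewrite [(_ * p)%N]mulnC mulrnA -[s i * b *+ p]mulrnAr pb0 mulr0 mul0rn add0r.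
move=> x xb_neq0.
(* As for Fermat's little theorem, multiplication by [x] permutes the nonzero elements of [V]. The
   product is taken over representatives [a v], since products inside [V] may vanish. *)
have /fin_all_exists[a Da] : forall v : R, exists y, v \in V -> y * b = v.
  by move=> v; have [/imsetP[y _ ->]|] := boolP (v \in V); [exists y | exists 0].
pose W := V :\ 0.
have cardW : #|W| = (p ^ r).-1.
  by rewrite -cardV (cardsD1 0 V) -{1}(mul0r b) VP.
have mulx_inj : {in W &, injective ( *%R x)}.
  move=> v w /setD1P[_ /imsetP[y _ ->]] /setD1P[_ /imsetP[y' _ ->]] /eqP.
  rewrite -subr_eq0 -mulrBr -mulrBl mulrA => /eqP/b_prime[/eqP xb0|].
    by rewrite (negPf xb_neq0) in xb0.
  by rewrite mulrBl => /subr0_eq.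
have xW : [set x * v | v in W] = W.
  apply/eqP; rewrite eqEcard card_in_imset // leqnn andbT.
  apply/subsetP=> _ /imsetP[v /setD1P[v_neq0 /imsetP[y _ Dv]] ->].
  rewrite !inE Dv mulrA VP andbT; rewrite Dv in v_neq0.
  by apply/eqP=> /b_prime[] /eqP; apply/negP.
have prodb (F G : R -> R) : {in W, forall v, F v * b = G v * b} ->
    (\prod_(v in W) F v) * b = (\prod_(v in W) G v) * b.
  move=> FG; apply: (big_rec2 (fun u w => u * b = w * b)) => // v u w Wv uw.
  by rewrite -mulrA uw mulrCA FG // mulrCA mulrA.
have prod_neq0 : (\prod_(v in W) a v) * b != 0.
  apply: (big_ind (fun u => u * b != 0)); first by rewrite mul1r.
    by move=> u w ub wb; apply/eqP=> /b_prime[] /eqP; apply/negP.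
  by move=> v /setD1P[v_neq0 Vv]; rewrite Da.
have /prodb : {in W, forall v, x * a v * b = a (x * v) * b}.
  move=> v Wv; have: x * v \in W by rewrite -xW imset_f.
  by move: Wv => /setD1P[_ Vv] /setD1P[_ Vxv]; rewrite -mulrA !Da.
rewrite big_split /= prodr_const cardW -(big_imset _ mulx_inj) xW.
move=> /eqP; rewrite -subr_eq0 -mulrBl -{2}[\prod_(v in W) _]mul1r -mulrBl.
case/eqP/b_prime => [|/eqP]; last by rewrite (negPf prod_neq0).
by rewrite mulrBl mul1r => /subr0_eq.
Qed.

(** A non-nilpotent [z] would survive in a field [R / Ann(b)] of order [p ^ r] with [r <= m], where
    the [n]-th power is a power of Frobenius, hence additive. *)
Lemma korselt_sum_expn_nilp (R : finComNzRingType) (m n : nat)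
    (s : 'I_m -> R) (x y : R) :
    (0 < n)%N -> n%:R = 0 :> R -> spans_nat s ->
    (forall p, prime p -> (p %| n)%N -> forall r, (1 <= r <= m)%N ->
       exists i : nat, n = (p ^ i)%N %[mod (p ^ r).-1]) ->
  ((x + y) ^+ n - x ^+ n - y ^+ n) ^+ #|R| = 0.
Proof.
move=> n_gt0 n0 spans kor; set z := _ - _.
apply/eqP; apply/negPn/negP => z_nn.
have [b zb_neq0 b_prime] := non_nilp_prime_annihilator z_nn.
(* As [n * b = 0] and [Ann(b)] is prime, some prime factor of [n] kills [b]. *)
have [p pr_p [p_n pb0]] : exists2 p, prime p & (p %| n)%N /\ b *+ p = 0.
  have [b_neq0 bP] := b_prime.
  have : n%:R * b = 0 by rewrite n0 mul0r.
  elim/ltn_ind: n n_gt0 {n0 kor z z_nn zb_neq0} => n IHn n_gt0 nb0.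
  have [n_le1 | n_gt1] := leqP n 1.
    by move: nb0 b_neq0; rewrite (@anti_leq n 1) ?n_le1 // mul1r => ->; rewrite eqxx.
  have pr_p := pdiv_prime n_gt1; have p_n := pdiv_dvd n.
  move: nb0; rewrite -{1}(divnK p_n) natrM => /bP[nb0|]; last first.
    by rewrite mulr_natl; exists (pdiv n).
  have np_gt0 : (0 < n %/ pdiv n)%N.
    by rewrite divn_gt0 ?(prime_gt0 pr_p) //; apply: dvdn_leq.
  have [q pr_q [q_n qb]] := IHn _ (ltn_Pdiv (prime_gt1 pr_p) n_gt0) np_gt0 nb0.
  by exists q => //; split=> //; apply: dvdn_trans q_n (dvdn_div p_n).
have [r rm fermat] := prime_annihilator_fermat pr_p pb0 spans b_prime.
have [i Dn] := kor p pr_p p_n r rm.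
(* Both exponents are positive, which settles [u * b = 0]; otherwise exponents matter only modulo
   [p ^ r - 1]. *)
have pow_b u : u ^+ n * b = u ^+ (p ^ i) * b.
  have [ub0 | ub_neq0] := eqVneq (u * b) 0.
    rewrite -(prednK n_gt0) -(@prednK (p ^ i)) ?expn_gt0 ?prime_gt0 //.
    by rewrite !exprSr -!mulrA ub0 !mulr0.
  have red k : u ^+ k * b = u ^+ (k %% (p ^ r).-1) * b.
    rewrite {1}(divn_eq k (p ^ r).-1) exprD mulnC exprM mulrAC mulrC; congr (_ * _).
    by elim: (_ %/ _)%N => [|l IHl]; rewrite ?mul1r // exprSr -mulrA fermat.
  by rewrite red Dn -red.
case/eqP: zb_neq0; rewrite /z !mulrBl !pow_b (exprD_prime_expn _ _ _ pr_p pb0).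
by rewrite [X in X - _ - _]addrC addrK subrr.
Qed.

(** * From the congruences to Carmichael numbers *)

Lemma fermat_little_coprime (p q : nat) :
  prime p -> prime q -> q != p -> (p %| (q ^ p.-1).-1)%N.
Proof.
move=> pr_p pr_q ne_qp.
rewrite -subn1 -eqn_mod_dvd ?expn_gt0 ?prime_gt0 //.
rewrite -{1}(totient_prime pr_p); apply/eqP/Euler_exp_totient.
by rewrite prime_coprime // dvdn_prime2.
Qed.

(** This bound makes the [p]-th power of a nilpotent element killed by [p] vanish, its [(m+1)]-th
    power being zero already. *)
Lemma korselt_order_ltn (m n p : nat) :
  composite n -> korselt_order m n -> prime p -> (p %| n)%N -> (m < p)%N.
Proof.
move=> [n_gt1 n_npr] [sqf kor] pr_p p_n; rewrite ltnNge; apply/negP=> le_pm.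
have n_gt0 := ltnW n_gt1.
have np_gt1 : (1 < n %/ p)%N.
  rewrite ltn_divRL // mul1n ltn_neqAle dvdn_leq // andbT.
  by apply: contraNneq n_npr => <-.
pose q := pdiv (n %/ p).
have pr_q : prime q by apply: pdiv_prime.
have q_np : (q %| n %/ p)%N by apply: pdiv_dvd.
have q_n : (q %| n)%N by apply: dvdn_trans q_np (dvdn_div p_n).
have ne_qp : q != p.
  apply: contraTneq q_np => ->; apply: contraNN (sqf p pr_p) => pnp.
  by rewrite -(divnK p_n) dvdn_pmul2r ?prime_gt0.
have r_int : (1 <= p.-1 <= m)%N.
  by rewrite -ltnS (ltn_predK (prime_gt1 pr_p)) prime_gt1 //
    (leq_trans (leq_pred p)).
have [i Dn] := kor q pr_q q_n p.-1 r_int.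
have : (p %| q ^ i)%N.
  move: p_n; rewrite /dvdn -(modn_dvdm n (fermat_little_coprime pr_p pr_q ne_qp)) Dn.
  by rewrite modn_dvdm // fermat_little_coprime.
by rewrite Euclid_dvdX // dvdn_prime2 // eq_sym (negPf ne_qp).
Qed.

Lemma spans_nat_sum_expn (R : comNzRingType) (m n : nat) (s : 'I_m -> R) (x y : R) :
    composite n -> n%:R = 0 :> R -> spans_nat s -> korselt_order m n ->
    (exists k, ((x + y) ^+ n - x ^+ n - y ^+ n) ^+ k = 0) ->
  (x + y) ^+ n = x ^+ n + y ^+ n.
Proof.
move=> comp n0 spans kor [l zl0]; have n_gt0 : (0 < n)%N by case: comp => /ltnW.
suff z0 : (x + y) ^+ n - x ^+ n - y ^+ n = 0.
  by apply/eqP; rewrite -subr_eq0 opprD addrA z0.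
move: zl0; set z := _ - _ => zl0.
have n_tors (u : R) : u *+ n = 0 by rewrite -mulr_natr n0 mulr0.
apply: (coprime_torsion0 n_gt0) => // p pr_p p_n.
have lt_mp := korselt_order_ltn comp kor pr_p p_n.
pose k := (n %/ p)%N; have Dn : n = (k * p)%N by rewrite divnK.
have co_pk : coprime p k.
  rewrite prime_coprime //; apply: contraNN (kor.1 p pr_p) => pk.
  by rewrite Dn dvdn_pmul2r ?prime_gt0.
exists (k ^ p)%N; first exact: coprimeXr.
pose w := (x + y) ^+ k - x ^+ k - y ^+ k.
(* Both [(x + y)^n] and [x^n + y^n] are expanded as [p]-th powers modulo [p], starting from
   [(x + y)^k = x^k + y^k + w]. *)
have [c Dz] : exists c, z = w ^+ p + c *+ p.
  have [c1 Dc1] := exprD_prime (x ^+ k + y ^+ k) w pr_p.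
  have [c2 Dc2] := exprD_prime (x ^+ k) (y ^+ k) pr_p.
  have Dw : x ^+ k + y ^+ k + w = (x + y) ^+ k.
    by rewrite /w; ring.
  exists (c1 + c2); rewrite /z Dn !exprM -Dw Dc1 Dc2 mulrnDl.
  ring.
pose v := w *+ k.
have vp : v ^+ p = z *+ (k ^ p).
  rewrite /v exprMn_n Dz mulrnDl -mulrnA.
  (* Scaling by [k ^ p] turns the error [c *+ p] into a multiple of [n], which is zero. *)
  have -> : (p * k ^ p = n * k ^ p.-1)%N.
    by rewrite -{2}(prednK (prime_gt0 pr_p)) expnS mulnA (mulnC p) -Dn.
  by rewrite mulrnA n_tors mul0rn addr0.
rewrite -vp -(subnK lt_mp) exprD.
suff -> : v ^+ m.+1 = 0 by rewrite mulr0.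
apply: (nilp_expS_eq0 (k := (p * l)%N) spans pr_p).
  by rewrite /v -mulrnA -Dn.
by rewrite exprM vp exprMn_n zl0 mul0rn.
Qed.

Lemma korselt_carmichael (m n : nat) :
  composite n -> korselt_order m n -> carmichael_of_order m n.
Proof.
move=> comp kor; split=> // A [s gen].
have [n_gt1 _] := comp; have n_gt0 := ltnW n_gt1.
have Zn0 : n%:R = 0 :> 'Z_n by rewrite pchar_Zp.
have A0 : n%:R = 0 :> A by rewrite -scaler_nat Zn0 scale0r.
have spans : spans_nat s.
  move=> x; have [c ->] := gen x; exists (fun i => c i).
  by apply: eq_bigr => i _; rewrite -{1}[c i]natr_Zp scaler_nat.
split=> [x y||]; [|exact: exprMn|exact: expr1n].
apply: (spans_nat_sum_expn comp A0 spans kor).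
(* Coefficient vectors surject onto [A]; a section of [comb] makes [A] a finite type with its ring
   structure unchanged. *)
pose comb (c : {ffun 'I_m -> 'Z_n}) : A := \sum_(i < m) c i *: s i.
have comb_surj u : exists c, comb c == u.
  have [c ->] := gen u; exists [ffun i => c i]; apply/eqP.
  by apply: eq_bigr => i _; rewrite ffunE.
pose coef u := xchoose (comb_surj u).
have coefK : @cancel {ffun 'I_m -> 'Z_n} A coef comb.
  by move=> u; apply/eqP/(xchooseP (comb_surj u)).
pose cA := isCountable.Build A (pcan_pickleK (can_pcan coefK)).
pose CA : countType := HB.pack (A : Type) (Choice.class A) cA.
pose fA := isFinite.Build CA (pcan_enumP (@can_pcan _ CA _ _ coefK)).
pose F : finComNzRingType := HB.pack (A : Type) (GRing.ComNzRing.class A) cA fA.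
exists #|F|.
exact: (@korselt_sum_expn_nilp F m n s x y n_gt0 A0 spans (proj2 kor)).
Qed.

(** * Squarefreeness from the algebra Z/n *)

Lemma natZp_eq0 (n k : nat) : (1 < n)%N -> (k%:R == 0 :> 'Z_n) = (n %| k)%N.
Proof. by move=> n_gt1; rewrite -val_eqE /= val_Zp_nat. Qed.

Lemma dvdn_natZp (n d k : nat) :
  (1 < n)%N -> (d %| n)%N -> (d %| (k%:R : 'Z_n))%N = (d %| k)%N.
Proof. by move=> n_gt1 d_n; rewrite /dvdn val_Zp_nat // modn_dvdm. Qed.

(** The component at [p] is the ideal of an idempotent [e], free of rank one on [e]; its trace
    matrix is [e] itself, which is 1 modulo [p]. *)
Lemma Zp_finite_etale (n : nat) : (1 < n)%N -> finite_etale (('Z_n)^o : comAlgType 'Z_n).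
Proof.
move=> n_gt1 p pr_p p_n; rewrite /local_component_etale; set q := (p ^ logn p n)%N.
have n_gt0 := ltnW n_gt1.
have p_q : (p %| q)%N by rewrite dvdn_exp // logn_gt0 mem_primes pr_p n_gt0.
have q_gt0 : (0 < q)%N by rewrite expn_gt0 prime_gt0.
have q_gt1 : (1 < q)%N by apply: leq_trans (prime_gt1 pr_p) (dvdn_leq _ p_q).
have q_n : (q %| n)%N by apply: pfactor_dvdnn.
pose n' := (n %/ q)%N; have Dn : n = (n' * q)%N by rewrite divnK.
have co_qn' : coprime q n'.
  rewrite coprime_pexpl ?logn_gt0 ?mem_primes ?pr_p ?n_gt0 // prime_coprime //.
  apply/negP=> p_n'; have : (p ^ (logn p n).+1 %| n)%N.
    by rewrite expnS [X in (_ %| X)%N]Dn dvdn_pmul2r.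
  by rewrite pfactor_dvdn // ltnn.
(* The Chinese remainder idempotent: 1 modulo [q], 0 modulo the prime-to-[p] part [n']. *)
pose c0 := chinese q n' 1 0; pose e : 'Z_n := c0%:R.
have c0_q : c0 = 1 %[mod q] by apply: chinese_modl.
have c0_n' : (n' %| c0)%N by apply/eqP; rewrite (chinese_modr co_qn') mod0n.
have xe (x : 'Z_n) : x *+ q = 0 -> x = x * e.
  move=> xq0; rewrite mulr_natr (divn_eq c0 q) c0_q (modn_small q_gt1) mulrnDr mulr1n.
  by rewrite mulnC mulrnA xq0 mul0rn add0r.
have eq0 : e *+ q = 0.
  by apply/eqP; rewrite /e -mulrnA natZp_eq0 // [X in (X %| _)%N]Dn dvdn_pmul2r.
exists 1%N, (fun _ => e), (fun x _ => x); split=> // [x xq0 | c | ].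
- by rewrite big_ord1; apply: xe.
- rewrite big_ord1 => /eqP ce0 i; rewrite (ord1 i).
  have : (c ord0 * e == 0) by [].
  rewrite -[c _]natr_Zp -natrM natZp_eq0 // => /(dvdn_trans q_n).
  rewrite Gauss_dvdl // ?natr_Zp //.
  by rewrite coprime_sym /coprime -gcdn_modl c0_q modn_small // gcd1n.
rewrite det_mx11 mxE big_ord1 -!xe // prime_coprime // dvdn_natZp //.
by rewrite /dvdn -(modn_dvdm c0 p_q) c0_q (modn_small q_gt1) modn_small ?prime_gt1.
Qed.

(** Additivity on ['Z_n] gives [k^n = k] for every [k]. If [p * p] divides [n], then [n / p] has
    square zero in ['Z_n], so it would vanish. *)
Lemma etale_carmichael_squarefree (m n : nat) :
  (0 < m)%N -> composite n -> etale_carmichael_of_order m n -> squarefree n.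
Proof.
move=> m_gt0 [n_gt1 _] etale p pr_p.
have [powD _ _] : pow_is_ring_endo n (('Z_n)^o : comAlgType 'Z_n).
  apply: etale (Zp_finite_etale n_gt1) _.
  exists (fun _ => 1) => x; exists (fun i => if i == Ordinal m_gt0 then x else 0).
  rewrite (bigD1 (Ordinal m_gt0)) //= ?eqxx big1 ?addr0 => [|i /negPf->].
    by rewrite [RHS]mulr1.
  by rewrite scale0r.
apply/negP => pp_n; have n_gt0 := ltnW n_gt1.
have p_n : (p %| n)%N by apply: dvdn_trans (dvdn_mulr p (dvdnn p)) pp_n.
have powE k : (k%:R : 'Z_n) ^+ n = k%:R.
  elim: k => [|k IHk]; first by rewrite expr0n -(prednK n_gt0).
  by rewrite -natr1 [LHS]powD IHk expr1n.
have : (n %/ p)%:R == 0 :> 'Z_n.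
  rewrite -powE -[X in _ ^+ X](subnK n_gt1) exprD -[_ ^+ 2]natrX.
  rewrite (_ : (_ ^ 2)%N%:R = 0) ?mulr0 //.
  apply/eqP; rewrite natZp_eq0 //.
  have /dvdnP[k Dn] := pp_n; have -> : (n %/ p)%N = (k * p)%N.
    by rewrite Dn mulnA mulnK ?prime_gt0.
  by rewrite expnMn {1}Dn; apply: dvdn_mul => //; apply: dvdn_mull.
rewrite natZp_eq0 // => /dvdn_leq.
rewrite divn_gt0 ?prime_gt0 // dvdn_leq // => /(_ isT).
by rewrite leqNgt ltn_Pdiv ?prime_gt1.
Qed.

(** * Additive power maps on finite fields *)

(** If [p] divides [k], injectivity of Frobenius removes a factor [p] from the exponent. Otherwise
    the derivatives at 0 force [k = 1]. *)
Lemma expnD_poly_prime_power (F : fieldType) (p k : nat) :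
    p \in [pchar F] -> (0 < k)%N -> ('X + 1) ^+ k = 'X ^+ k + 1 :> {poly F} ->
  exists i, k = (p ^ i)%N.
Proof.
move=> pF; have pr_p := pcharf_prime pF; elim/ltn_ind: k => k IHk k_gt0 Dk.
have pP : p \in [pchar {poly F}] by rewrite pchar_poly.
have [/dvdnP[k' Dk']|not_pk] := boolP (p %| k)%N.
  have k'_gt0 : (0 < k')%N by move: k_gt0; rewrite Dk' muln_gt0 => /andP[].
  have lt_k'k : (k' < k)%N by rewrite Dk' ltn_Pmulr ?prime_gt1.
  have [|i Dk'i] := IHk k' lt_k'k k'_gt0; last by exists i.+1; rewrite Dk' Dk'i expnSr.
  have frob0 (P : {poly F}) : P ^+ p = 0 -> P == 0.
    by move/eqP; rewrite expf_eq0 => /andP[].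
  apply/eqP; rewrite -subr_eq0; apply: frob0.
  rewrite -(pFrobenius_autE pP) rmorphB rmorphD rmorph1 /= !pFrobenius_autE.
  by rewrite -!exprM -Dk' Dk subrr.
exists 0%N; apply/eqP; apply: contraR not_pk => k_neq1.
have : ((('X + 1) ^+ k)^`()).[0] = (('X ^+ k + 1)^`()).[0] :> F by rewrite Dk.
have /negPf k1_neq0 : k.-1 != 0%N.
  by rewrite -lt0n -ltnS prednK // ltn_neqAle eq_sym k_neq1.
rewrite deriv_exp.
rewrite !(derivE, hornerE, hornerMn, expr1n, expr0n, k1_neq0, mul0rn) /=.
by move/eqP; rewrite (dvdn_pcharf pF).
Qed.

(** For the reduced exponent [k], [(X + 1)^k - X^k - 1] has degree below [#|F|] and vanishes on [F],
    so it is zero. *)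
Lemma finField_pow_additive (F : finFieldType) (p n : nat) :
    p \in [pchar F] -> (0 < n)%N ->
    (forall x y : F, (x + y) ^+ n = x ^+ n + y ^+ n) ->
  exists i, n = (p ^ i)%N %[mod #|F|.-1].
Proof.
move=> pF n_gt0 powD; set N := #|F|.-1.
have DF : #|F| = N.+1 by rewrite /N (ltn_predK (finNzRing_gt1 F)).
have N_gt0 : (0 < N)%N by rewrite -ltnS -DF finNzRing_gt1.
(* The shift puts [k] between 1 and [N], so [x^n = x^k] holds at [x = 0] as well. *)
pose k := (n.-1 %% N).+1.
have Dn : n = (n.-1 %/ N * N + k)%N by rewrite addnS -divn_eq prednK.
have powE (x : F) : x ^+ n = x ^+ k.
  have xN : x ^+ (N + k) = x ^+ k.
    by rewrite addnS -addSn exprD -DF expf_card -exprS.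
  rewrite [in LHS]Dn; elim: (_ %/ N)%N => // l IHl.
  by rewrite mulSn -addnA addnCA exprD xN -exprD.
have [|i Dk] := @expnD_poly_prime_power F p k pF isT.
  apply/eqP; rewrite -subr_eq0; apply/negPn/negP=> P_neq0.
  have roots : all (root (('X + 1) ^+ k - ('X^k + 1))) (enum F).
    by apply/allP=> x _; rewrite rootE !hornerE /= -!powE powD expr1n subrr.
  have := max_poly_roots P_neq0 roots (enum_uniq F).
  rewrite -cardE DF ltnNge => /negP[].
  apply: leq_trans (size_polyD _ _) _.
  rewrite geq_max size_polyN; apply/andP; split.
    have -> : 'X + 1 = 'X - (-1)%:P :> {poly F} by rewrite polyCN opprK.
    by rewrite size_exp_XsubC ltnS ltn_pmod.
  apply: leq_trans (size_polyD _ _) _.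
  by rewrite geq_max size_polyXn size_poly1 !ltnS ltn_pmod.
by exists i; rewrite {1}Dn -Dk modnMDl.
Qed.

(** * Finite fields as finite étale algebras over Z/n *)

Section ZpAlgebra.

Variables (n : nat) (R : comNzRingType).

(** A copy of [R] whose type records both hypotheses, so that the algebra instances can depend on
    them. *)
Definition Zp_alg of (1 < n)%N & n%:R = 0 :> R : Type := R.

Hypotheses (n_gt1 : (1 < n)%N) (n0 : n%:R = 0 :> R).
Local Notation A := (Zp_alg n_gt1 n0).

HB.instance Definition _ := GRing.ComNzRing.on A.

Definition Zp_scale (c : 'Z_n) (x : A) : A := x *+ c.

Lemma mulrn_natZp (x : A) k : x *+ (k%:R : 'Z_n) = x *+ k.
Proof.
rewrite val_Zp_nat // [in RHS](divn_eq k n) mulrnDr mulnC mulrnA.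
by rewrite -[x *+ n]mulr_natr n0 mulr0 mul0rn add0r.
Qed.

Lemma Zp_scaleA a b x : Zp_scale a (Zp_scale b x) = Zp_scale (a * b) x.
Proof.
by rewrite /Zp_scale -mulrnA mulnC -(mulrn_natZp x (a * b)%N) natrM !natr_Zp.
Qed.

Lemma Zp_scale1 : left_id 1 Zp_scale.
Proof. by move=> x; rewrite /Zp_scale -[1]/(1%:R) mulrn_natZp. Qed.

Lemma Zp_scaleDr : right_distributive Zp_scale +%R.
Proof. by move=> c x y; apply: mulrnDl. Qed.

Lemma Zp_scaleDl x : {morph Zp_scale^~ x : a b / a + b}.
Proof.
by move=> a b; rewrite /Zp_scale -mulrnDr -(mulrn_natZp x (a + b)%N) natrD !natr_Zp.
Qed.

HB.instance Definition _ := GRing.Zmodule_isLmodule.Build 'Z_n A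
  Zp_scaleA Zp_scale1 Zp_scaleDr Zp_scaleDl.

Lemma Zp_scaleAl (c : 'Z_n) (x y : A) : c *: (x * y) = (c *: x) * y.
Proof. by rewrite /GRing.scale /= /Zp_scale mulrnAl. Qed.

HB.instance Definition _ := GRing.Lmodule_isLalgebra.Build 'Z_n A Zp_scaleAl.

Lemma Zp_scaleAr (c : 'Z_n) (x y : A) : c *: (x * y) = x * (c *: y).
Proof. by rewrite /GRing.scale /= /Zp_scale mulrnAr. Qed.

HB.instance Definition _ := GRing.Lalgebra_isAlgebra.Build 'Z_n A Zp_scaleAr.

Lemma Zp_algZE (c : 'Z_n) (x : A) : c *: x = x *+ c.
Proof. by []. Qed.

End ZpAlgebra.

(* A basis over the prime field, with coordinates represented by natural numbers. *)
Definition nat_basis (p : nat) (V : nmodType) (d : nat) (b : 'I_d -> V)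
    (co : V -> 'I_d -> nat) : Prop :=
  (forall x, x = \sum_(i < d) b i *+ co x i) /\
  (forall c : 'I_d -> nat, \sum_(i < d) b i *+ c i = 0 -> forall i, (p %| c i)%N).

Lemma finField_nat_basis (F : finFieldType) (p r : nat) :
    p \in [pchar F] -> #|F| = (p ^ r)%N ->
  exists (b : 'I_r -> F) co, nat_basis p b co.
Proof.
move=> pF cardF; have pr_p := pcharf_prime pF.
pose K := pPrimeCharType pF; pose X := vbasis {: K}.
have Dr : \dim {: K} = r.
  by apply: (expnI (prime_gt1 pr_p)); rewrite pprimeChar_dimf -card_pprimeChar.
rewrite -Dr.
have scaleE (a : 'F_p) (x : K) : a *: x = x *+ a by rewrite -{1}[a]natr_Zp scaler_nat.
exists (fun i => X`_i), (fun (x : F) i => nat_of_ord (coord X i (x : K))); split=> [x|c].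
  rewrite {1}(coord_vbasis (memvf (x : K))).
  by apply: eq_bigr => i _; rewrite scaleE.
move=> sum0 i; rewrite (dvdn_pcharf (pchar_Fp pr_p)).
have /freeP/(_ (fun i => (c i)%:R))-> // := basis_free (vbasisP {: K}).
by rewrite -[RHS]sum0; apply: eq_bigr => j _; rewrite scaler_nat.
Qed.

(** * The trace form of a finite field *)

Section TraceForm.

Variables (F : finFieldType) (p r : nat) (b : 'I_r -> F) (co : F -> 'I_r -> nat).
Hypotheses (pF : p \in [pchar F]) (cardF : #|F| = (p ^ r)%N).
Hypothesis bE : forall x, x = \sum_(i < r) b i *+ co x i.

Let pr_p : prime p := pcharf_prime pF.

Lemma expn_pchar_sum k (c : 'I_r -> nat) :
  (\sum_(i < r) b i *+ c i) ^+ (p ^ k) = \sum_(i < r) b i ^+ (p ^ k) *+ c i.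
Proof.
have powD (x y : F) : (x + y) ^+ (p ^ k) = x ^+ (p ^ k) + y ^+ (p ^ k).
  apply: exprDn_pchar; apply/pnatP; rewrite ?expn_gt0 ?prime_gt0 // => q pr_q.
  by rewrite Euclid_dvdX // => /andP[]; rewrite dvdn_prime2 // => /eqP->.
have pow0 : (0 : F) ^+ (p ^ k) = 0 by rewrite expr0n eqn0Ngt expn_gt0 prime_gt0.
rewrite (big_morph _ powD pow0); apply: eq_bigr => i _.
by elim: (c i) => [|l IHl]; rewrite ?mulr0n // !mulrS powD IHl.
Qed.

(** The Moore matrix of the basis: row [i] lists the Frobenius conjugates of [b i]. *)
Let V : 'M[F]_r := \matrix_(i, k) b i ^+ (p ^ k).

(* A relation between the columns of [V] is a polynomial of degree at most
   [p ^ r.-1] vanishing on the whole of [F]. *)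
Lemma frobenius_mx_unit : V \in unitmx.
Proof.
rewrite -unitmx_tr -row_free_unit -kermx_eq0; apply/rowV0P=> u /sub_kermxP uV0.
pose P : {poly F} := \sum_(k < r) u 0 k *: 'X^(p ^ k).
have P0 : P = 0.
  apply/eqP/negPn/negP=> P_neq0.
  have roots : all (root P) (enum F).
    apply/allP=> x _; rewrite rootE horner_sum.
    rewrite (eq_bigr (fun k : 'I_r => \sum_(i < r) u 0 k * b i ^+ (p ^ k) *+ co x i)).
      rewrite exchange_big big1 //= => i _.
      have /matrixP/(_ 0 i) := uV0; rewrite !mxE => uVi.
      transitivity ((\sum_k u 0 k * V^T k i) *+ co x i); last by rewrite uVi mul0rn.
      by rewrite -sumrMnl; apply: eq_bigr => k _; rewrite !mxE.
    move=> k _; rewrite hornerZ hornerXn {1}(bE x) expn_pchar_sum mulr_sumr.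
    by apply: eq_bigr => i _; rewrite mulrnAr.
  have := max_poly_roots P_neq0 roots (enum_uniq F).
  rewrite -cardE cardF ltnNge => /negP[].
  apply: leq_trans (size_sum _ _ _) _; apply/bigmax_leqP=> k _.
  apply: leq_trans (size_scale_leq _ _) _.
  by rewrite size_polyXn ltn_exp2l ?prime_gt1.
(* The exponents [p ^ k] are distinct, so each [u 0 k] is a coefficient of [P]. *)
apply/rowP=> k; rewrite mxE -[RHS](coef0 _ (p ^ k)) -P0 coef_sum.
rewrite (bigD1 k) //= coefZ coefXn eqxx mulr1 big1 ?addr0 // => j ne_jk.
by rewrite coefZ coefXn eqn_exp2l ?prime_gt1 // val_eqE eq_sym (negPf ne_jk) mulr0.
Qed.

(* [V] diagonalizes the multiplication by [y], with eigenvalues the conjugates of [y]. *)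
Lemma trace_mul_basis (y : F) :
  \sum_(l < r) (co (y * b l) l)%:R = \sum_(k < r) y ^+ (p ^ k) :> F.
Proof.
pose M : 'M[F]_r := \matrix_(l, j) (co (y * b l) j)%:R.
pose D : 'M[F]_r := diag_mx (\row_k y ^+ (p ^ k)).
have MV : M *m V = V *m D.
  apply/matrixP=> l k; rewrite mul_mx_diag !mxE.
  transitivity ((y * b l) ^+ (p ^ k)); last by rewrite exprMn mulrC.
  rewrite [y * b l in RHS]bE expn_pchar_sum.
  by apply: eq_bigr => j _; rewrite !mxE mulr_natl.
transitivity (\tr M); first by apply: eq_bigr => l _; rewrite mxE.
have -> : M = V *m D *m invmx V by rewrite -MV mulmxK ?frobenius_mx_unit.
rewrite mxtrace_mulC mulmxA mulVmx ?frobenius_mx_unit // mul1mx mxtrace_diag.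
by apply: eq_bigr => k _; rewrite mxE.
Qed.

Lemma det_trace_form_neq0 :
  \det (\matrix_(i < r, j < r) \sum_(l < r) (co (b i * b j * b l) l)%:R : 'M[F]_r) != 0.
Proof.
have -> : \matrix_(i, j) \sum_(l < r) (co (b i * b j * b l) l)%:R = V *m V^T.
  apply/matrixP=> i j; rewrite !mxE trace_mul_basis.
  by apply: eq_bigr => k _; rewrite !mxE exprMn.
by rewrite det_mulmx det_tr mulf_neq0 // -unitfE; apply: frobenius_mx_unit.
Qed.

End TraceForm.

(** * From étale algebras to the congruences *)

(** Squarefreeness makes every local factor of ['Z_n] a prime field. Only the component at [p] is
    nonzero, and there the determinant maps to that of the trace form of [F]. *)
Lemma finField_finite_etale (n p r : nat) (F : finFieldType)
    (n_gt1 : (1 < n)%N) (n0 : n%:R = 0 :> F) :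
    squarefree n -> p \in [pchar F] -> #|F| = (p ^ r)%N ->
  finite_etale (Zp_alg n_gt1 n0 : comAlgType 'Z_n).
Proof.
move=> sqf pF cardF p' pr_p' p'_n; have pr_p := pcharf_prime pF.
set A : comAlgType 'Z_n := Zp_alg n_gt1 n0.
have logn1 : logn p' n = 1%N.
  apply/eqP; rewrite eqn_leq; apply/andP; split.
    by rewrite leqNgt -pfactor_dvdn ?(ltnW n_gt1) //; apply: sqf.
  by rewrite logn_gt0 mem_primes pr_p' p'_n ltnW.
rewrite /local_component_etale logn1 expn1.
have [Dp' | ne_p'p] := eqVneq p' p; last first.
  (* Away from [p] the component is the zero ring: empty basis, determinant 1. *)
  exists 0%N, (fun _ => 0), (fun _ _ => 0); split.
  - by case.
  - move=> x x0; rewrite big_ord0; apply: (coprime_torsion0 (prime_gt0 pr_p') x0).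
    move=> q pr_q; rewrite dvdn_prime2 // => /eqP->; exists p.
      by rewrite prime_coprime // dvdn_prime2.
    by apply: (mulrn_pchar pF).
  - by move=> c _ [].
  - rewrite det_mx00 prime_coprime // -[1]/(1%:R) dvdn_natZp //.
    by rewrite dvdn1 gtn_eqF ?prime_gt1.
have [b [co [bE b_free]]] := finField_nat_basis pF cardF.
exists r, b, (fun x i => (co x i)%:R); rewrite Dp'; split.
- by move=> i; apply: (mulrn_pchar pF).
- move=> x _; rewrite {1}(bE x); apply: eq_bigr => i _.
  by rewrite scaler_nat.
- by move=> c c0 i; apply: (b_free (fun i => c i)).
rewrite prime_coprime //; set d := \det _.
apply: contra (det_trace_form_neq0 pF cardF bE) => p_d.
(* The structure map sends [d] to the determinant over [F], and to 0 if [p] divides [d]. *)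
apply/eqP; transitivity (in_alg A d); last first.
  case/dvdnP: p_d => k dE; rewrite /= Zp_algZE dE mulnC mulrnA.
  by rewrite (_ : 1 *+ p = 0) ?mul0rn //; apply: (mulrn_pchar pF).
rewrite -det_map_mx; congr (\det _); apply/matrixP=> i j.
rewrite !mxE rmorph_sum; apply: eq_bigr => l _.
by rewrite rmorph_nat.
Qed.

Lemma Zp_alg_generated (n m p r : nat) (F : finFieldType)
    (n_gt1 : (1 < n)%N) (n0 : n%:R = 0 :> F) :
    (r <= m)%N -> p \in [pchar F] -> #|F| = (p ^ r)%N ->
  module_generated_by m (Zp_alg n_gt1 n0 : comAlgType 'Z_n).
Proof.
move=> le_rm pF cardF.
have [b [co [bE _]]] := finField_nat_basis pF cardF.
(* The [r] basis elements are padded with zeros to [m] generators. *)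
exists (fun i => oapp b 0 (insub (val i))) => x.
exists (fun i => oapp (fun j => (co x j)%:R) 0 (insub (val i))).
rewrite (bigID (fun i : 'I_m => (i < r)%N)) /= [X in _ + X]big1 ?addr0.
  rewrite (big_ord_narrow le_rm) {1}(bE x); apply: eq_bigr => j _.
  by rewrite valK /= scaler_nat.
by move=> i nlt; rewrite insubN //= scaler0.
Qed.

Lemma etale_carmichael_korselt (m n : nat) :
  (0 < m)%N -> composite n -> etale_carmichael_of_order m n -> korselt_order m n.
Proof.
move=> m_gt0 comp etale; have [n_gt1 _] := comp.
have sqf := etale_carmichael_squarefree m_gt0 comp etale.
split=> // p pr_p p_n r /andP[r_gt0 le_rm].
have [F pF cardF] := pPrimePowerField pr_p r_gt0.
have n0 : n%:R = 0 :> F by apply/eqP; rewrite -(dvdn_pcharf pF).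
have [powD _ _] := etale _ (finField_finite_etale n_gt1 n0 sqf pF cardF)
  (Zp_alg_generated n_gt1 n0 le_rm pF cardF).
by have [i] := finField_pow_additive pF (ltnW n_gt1) powD; rewrite cardF; exists i.
Qed.

Theorem theorem1 (m n : nat) (hm : (0 < m)%N) (hn : composite n) :
  (carmichael_of_order m n <-> etale_carmichael_of_order m n) /\
  (etale_carmichael_of_order m n <-> korselt_order m n).
Proof.
have ab : carmichael_of_order m n -> etale_carmichael_of_order m n.
  by move=> [_ carm] A _; apply: carm.
have bc := etale_carmichael_korselt hm hn.
have ca := korselt_carmichael hn.
split; first by split=> // /bc/ca.
by split=> // /ca/ab.
Qed.
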